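(* The rational functions $U_n(z)$, $V_n(z)$ ($n=0,1,2,\dots$) form a biorthogonal system with respect to the functional $\sigma$: $$\sigma\{U_n(z)V_m(z)\}=h_n\,\delta_{nm},\qquad n,m=0,1,2,\dots,$$ where the normalization coefficients are $$h_n=\frac{\kappa_n}{\kappa_{n-1}}\,(\kappa_{n-1}-\kappa_n)\quad (n\ge 1),\qquad h_0=\kappa_0 .$$
   Context: Let $\{a_n\}_{n\ge1}$, $\{b_n\}_{n\ge1}$, $\{\alpha_n\}_{n\ge0}$, $\{\beta_n\}_{n\ge0}$, $\{r_n\}_{n\ge1}$ be complex sequences with $\alpha_0=-1$, $\alpha_n+r_n+1=0$ and $r_n\neq0$ for $n\ge1$. Let $P_n(z)=z^n+O(z^{n-1})$ be the monic polynomials defined by $P_0=1$, $P_1=z-\beta_0$ and $$P_{n+1}(z)+(\alpha_nz+\beta_n)P_n(z)+r_n(z-a_n)(z-b_n)P_{n-1}(z)=0,\qquad n\ge1.$$ Put $A_0=B_0=1$, $A_n(z)=\prod_{k=1}^n(z-a_k)$, $B_n(z)=\prod_{k=1}^n(z-b_k)$. It is assumed that the zeros of the polynomials $P_n$ do not coincide with any of the points $a_i,b_j$. $\sigma$ is a linear functional on the space of rational functions of the form $q(z)/(A_n(z)B_n(z))$, $n\ge0$, $q$ a polynomial of degree at most $2n$, such that for every $n$ $$\sigma\left\{\frac{P_n(z)q_j(z)}{A_n(z)B_n(z)}\right\}=0\quad\text{for every polynomial } q_j \text{ of degree at most } j,\ j=0,1,\dots,n-1,$$ and $$\sigma\left\{\frac{P_n(z)z^n}{A_n(z)B_n(z)}\right\}=\kappa_n,\qquad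 n=0,1,2,\dots$$ The normalization coefficients satisfy $\kappa_{n+1}+\alpha_n\kappa_n+r_n\kappa_{n-1}=0$ for $n\ge1$. Standing nondegeneracy assumptions: $\kappa_n\ne0$ for all $n\ge0$ and $\kappa_1\neq\kappa_0$ (hence $\kappa_n\ne\kappa_{n-1}$ for all $n\ge1$). Define $R^{(1)}_n(z)=P_n(z)/A_n(z)$, $R^{(2)}_n(z)=P_n(z)/B_n(z)$, $\xi_n=\kappa_n/\kappa_{n-1}$ for $n\ge1$, and $U_0=V_0=1$, $$U_n(z)=R^{(1)}_n(z)-\xi_nR^{(1)}_{n-1}(z),\qquad V_n(z)=R^{(2)}_n(z)-\xi_nR^{(2)}_{n-1}(z),\qquad n\ge1.$$ $\delta_{nm}$ is the Kronecker delta. *)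

(* Defs.v *)
From HB Require Import structures.
From mathcomp Require Import all_boot all_order all_algebra.
From mathcomp Require Import complex.
From mathcomp Require Import reals.

Set Implicit Arguments.
Unset Strict Implicit.
Unset Printing Implicit Defensive.

Import GRing.Theory.
Local Open Scope ring_scope.

Notation "x %:F" := (@FracField.tofrac _ x) : ring_scope.

(* The sequences a, b, alpha, beta, r, kappa are functions on nat; a, b, r
   are only meaningful from index 1 on, and their value at 0 is never used. *)

Section RationalFunctions.
Variable F : fieldType.
Implicit Types (a b kappa : nat -> F) (P : nat -> {poly F}).

(* A_n = nodepoly a n and B_n = nodepoly b n *)
Definition nodepoly a (n : nat) : {poly F} :=
  \prod_(1 <= k < n.+1) ('X - (a k)%:P).

Definition rfspace a b (f : {fraction {poly F}}) : Prop :=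
  exists n (q : {poly F}),
    (size q <= (2 * n).+1)%N /\ f = q%:F / (nodepoly a n * nodepoly b n)%:F.

(* A linear functional on the subspace W is represented by a total function
   whose values outside W are unconstrained. The scalar c acts on rational
   functions as multiplication by the constant function c. *)
Definition linear_functional_on (W : {fraction {poly F}} -> Prop)
    (sigma : {fraction {poly F}} -> F) : Prop :=
  forall (c : F) (f g : {fraction {poly F}}), W f -> W g ->
    sigma ((c%:P)%:F * f + g) = c * sigma f + sigma g.

(* R^(1)_n = ratfun P a n and R^(2)_n = ratfun P b n *)
Definition ratfun P a (n : nat) : {fraction {poly F}} :=
  (P n)%:F / (nodepoly a n)%:F.

Definition xi kappa (n : nat) : F := kappa n / kappa n.-1.

(* U_n = biorth P a kappa n and V_n = biorth P b kappa n *)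
Definition biorth P a kappa (n : nat) : {fraction {poly F}} :=
  if n is m.+1 then
    ratfun P a n - ((xi kappa n)%:P)%:F * ratfun P a m
  else 1.

Definition hnorm kappa (n : nat) : F :=
  if n is m.+1 then kappa n / kappa m * (kappa m - kappa n) else kappa 0%N.

End RationalFunctions.

(* Main.v *)
Require Import Defs.
From HB Require Import structures.
From mathcomp Require Import all_boot all_order all_algebra.
From mathcomp Require Import complex.
From mathcomp Require Import reals.
From mathcomp Require Import zify ring.

Set Implicit Arguments.
Unset Strict Implicit.
Unset Printing Implicit Defensive.

Import GRing.Theory.
Local Open Scope ring_scope.

(** Two facts drive the biorthogonality.

    First, since [P n] is monic of degree [n], the orthogonality and the
    normalization of [sigma] together say that
    [q |-> sigma (P n * q / (A_n * B_n))] is [kappa n] times the coefficient of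
    ['X^n], on all polynomials [q] of degree at most [n]
    ([reads_leading_coef]).  For [m <= n], the product [R^(1)_n * R^(2)_m] is
    [P n * q / (A_n * B_n)] with [q = P m * (B_n / B_m)] monic of degree [n];
    exchanging the two families of nodes covers [n <= m].  Hence the Gram matrix
    of the [R^(1)_n] against the [R^(2)_m] is [kappa (maxn n m)]
    ([sigma_ratfun]).

    Second, in such a matrix everything above the diagonal depends on the column
    alone, and everything below on the row alone.  Subtracting [xi_n] times row
    [n.-1] from row [n] therefore puts [kappa n - xi_n * kappa n.-1 = 0] at
    every place below the diagonal, the same operation on columns clears what
    lies above it, and neither spoils the other; this is what passing from [R]
    to [U] and [V] does.  On the diagonal there remains
    [kappa n - kappa n ^+ 2 / kappa n.-1]. *)

Section BiorthogonalRationalFunctions.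
Variable F : fieldType.
Implicit Types (a b kappa : nat -> F) (P : nat -> {poly F}) (q : {poly F}).
Implicit Types (f g : {fraction {poly F}}) (sigma : {fraction {poly F}} -> F).

(** * Node polynomials and the space of rational functions *)

Definition node_tail a (m n : nat) : {poly F} :=
  \prod_(m.+1 <= k < n.+1) ('X - (a k)%:P).

Lemma nodepolyS_tail a m n : (m <= n)%N ->
  nodepoly a n = nodepoly a m * node_tail a m n.
Proof. by move=> le_mn; rewrite /nodepoly (@big_cat_nat _ _ _ m.+1). Qed.

Lemma node_tail_monic a m n : node_tail a m n \is monic.
Proof. by apply: monic_prod => k _; exact: monicXsubC. Qed.

Lemma size_node_tail a m n : size (node_tail a m n) = (n - m).+1.
Proof. by rewrite size_prod_XsubC size_iota subSS. Qed.

Lemma tofrac_monic_neq0 q : q \is monic -> q%:F != 0.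
Proof. by move=> q_mon; rewrite tofrac_eq0 monic_neq0. Qed.

(** Two elements of the space can be added only over a common denominator. *)
Lemma rfspace_widen a b m n q : (m <= n)%N -> (size q <= (2 * m).+1)%N ->
  exists2 q' : {poly F}, (size q' <= (2 * n).+1)%N
    & q%:F / (nodepoly a m * nodepoly b m)%:F
      = q'%:F / (nodepoly a n * nodepoly b n)%:F.
Proof.
move=> le_mn size_q; exists (q * (node_tail a m n * node_tail b m n)).
  rewrite (leq_trans (size_polyMleq _ _)) //.
  rewrite (size_monicM (node_tail_monic _ _ _)) ?monic_neq0 ?node_tail_monic //.
  rewrite !size_node_tail; lia.
have tail_neq0 : (node_tail a m n * node_tail b m n)%:F != 0.
  by rewrite tofrac_monic_neq0 // rpredM ?node_tail_monic.
rewrite (nodepolyS_tail a le_mn) (nodepolyS_tail b le_mn) mulrACA.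
by rewrite [X in _ = X / _]tofracM [X in _ = _ / X]tofracM -mulf_div divff ?mulr1.
Qed.

Lemma rfspace_lincomb a b (c : F) f g :
  rfspace a b f -> rfspace a b g -> rfspace a b (c%:P%:F * f + g).
Proof.
move=> [m [p [size_p ->]]] [n [q [size_q ->]]].
have [p' size_p' ->] := rfspace_widen a b (leq_maxl m n) size_p.
have [q' size_q' ->] := rfspace_widen a b (leq_maxr m n) size_q.
exists (maxn m n), (c%:P * p' + q'); split; last first.
  by rewrite mulrA -mulrDl -tofracM -tofracD.
rewrite (leq_trans (size_polyD _ _)) // geq_max size_q' andbT.
by rewrite mul_polyC (leq_trans (size_scale_leq _ _)).
Qed.

Lemma rfspaceC a b f : rfspace a b f -> rfspace b a f.
Proof.
by move=> [n [q [size_q ->]]]; exists n, q; rewrite [nodepoly b n * _]mulrC.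
Qed.

Lemma ratfun_mulE P a b m n : (m <= n)%N ->
  ratfun P a n * ratfun P b m
  = (P n * (P m * node_tail b m n))%:F / (nodepoly a n * nodepoly b n)%:F.
Proof.
move=> le_mn; have tail_neq0 := tofrac_monic_neq0 (node_tail_monic b m n).
rewrite /ratfun mulf_div -!tofracM (nodepolyS_tail b le_mn) !mulrA.
by rewrite [X in _ = X / _]tofracM [X in _ = _ / X]tofracM -mulf_div divff ?mulr1.
Qed.

Section Functional.
Variables (a b : nat -> F) (sigma : {fraction {poly F}} -> F).
Hypothesis sigma_lin : linear_functional_on (rfspace a b) sigma.

Let rfspace0 : rfspace a b 0.
Proof. by exists 0%N, 0; rewrite size_poly0 rmorph0 mul0r. Qed.

Lemma sigma0 : sigma 0 = 0.
Proof.
have := sigma_lin 1 rfspace0 rfspace0.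
by rewrite mulr0 addr0 mul1r -[LHS]addr0 => /addrI.
Qed.

Lemma sigma_subZ (c : F) f g : rfspace a b f -> rfspace a b g ->
  sigma (f - c%:P%:F * g) = sigma f - c * sigma g.
Proof.
by move=> Wf Wg; rewrite addrC -mulNr -!rmorphN sigma_lin // mulNr addrC.
Qed.

Lemma rfspace_subZ (c : F) f g : rfspace a b f -> rfspace a b g ->
  rfspace a b (f - c%:P%:F * g).
Proof.
by move=> Wf Wg; rewrite addrC -mulNr -!rmorphN; exact: rfspace_lincomb.
Qed.

End Functional.

(** * Monicity of the recurrence polynomials *)

(** The relation [alpha n + r n + 1 = 0] is exactly what makes the leading
    coefficients [1], [alpha n] and [r n] of the three terms balance. *)
Lemma recurrence_monic a b (alpha beta r : nat -> F) P :
  (forall n, (1 <= n)%N -> alpha n + r n + 1 = 0) ->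
  P 0%N = 1 -> P 1%N = 'X - (beta 0%N)%:P ->
  (forall n, (1 <= n)%N ->
     P n.+1 + ((alpha n)%:P * 'X + (beta n)%:P) * P n
       + (r n)%:P * ('X - (a n)%:P) * ('X - (b n)%:P) * P n.-1 = 0) ->
  forall n, P n \is monic /\ size (P n) = n.+1.
Proof.
move=> alpha_r P0 P1 Prec n.
suff [] : (P n \is monic /\ size (P n) = n.+1)
  /\ (P n.+1 \is monic /\ size (P n.+1) = n.+2) by [].
elim: n => [|n [[Pn_mon size_Pn] [PSn_mon size_PSn]]].
  by rewrite P0 P1 monic1 size_poly1 monicXsubC size_XsubC.
split=> //; set p := P n.+2.
pose u := 'X * P n.+1; pose v := ('X - (a n.+1)%:P) * ('X - (b n.+1)%:P) * P n.
have u_mon : u \is monic by rewrite rpredM ?monicX.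
have v_mon : v \is monic by rewrite !rpredM ?monicXsubC.
have size_u : size u = n.+3 by rewrite /u mulrC size_mulX ?monic_neq0 // size_PSn.
have size_v : size v = n.+3.
  rewrite size_monicM ?rpredM ?monicXsubC ?monic_neq0 //.
  by rewrite size_mul ?polyXsubC_eq0 // !size_XsubC size_Pn.
have pE : p = - (alpha n.+1 *: u + beta n.+1 *: P n.+1 + r n.+1 *: v).
  apply/eqP; rewrite -addr_eq0 -!mul_polyC -(Prec n.+1) //= /u /v.
  by rewrite /p; apply/eqP; ring.
have p_top : p`_n.+2 = 1.
  move/monicP: u_mon; move/monicP: v_mon; rewrite !lead_coefE size_u size_v /=.
  move=> v_top u_top; rewrite pE coefN !coefD !coefZ u_top v_top.
  rewrite [(P n.+1)`__]nth_default ?size_PSn // mulr0 addr0 !mulr1.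
  by apply/eqP; rewrite eqr_oppLR -subr_eq0 opprK alpha_r.
have size_p : size p = n.+3.
  apply/eqP; rewrite eqn_leq; apply/andP; split; last first.
    rewrite ltnNge; apply/negP => /(nth_default 0); rewrite p_top => /eqP.
    by rewrite oner_eq0.
  apply/leq_sizeP => j le_j; rewrite pE coefN !coefD !coefZ.
  rewrite !nth_default ?size_u ?size_v ?size_PSn //; last exact: ltnW.
  by rewrite !mulr0 !addr0 oppr0.
by rewrite size_p monicE lead_coefE size_p p_top.
Qed.

(** * The Gram matrix of the two families *)

(** Orthogonality and normalization in one formula. It determines [sigma] on
    every [P n * q] regardless of how [q] arises, and it is symmetric in the two
    families of nodes, which halves the computation of the Gram matrix. *)
Definition reads_leading_coef a b kappa P sigma : Prop :=
  forall n q, (size q <= n.+1)%N ->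
    sigma ((P n * q)%:F / (nodepoly a n * nodepoly b n)%:F) = kappa n * q`_n.

(** Splitting off the top term of [q], orthogonality kills what remains. *)
Lemma orthogonal_reads_leading_coef a b kappa P sigma :
  linear_functional_on (rfspace a b) sigma ->
  (forall n, size (P n) = n.+1) ->
  (forall n j q, (j < n)%N -> (size q <= j.+1)%N ->
     sigma ((P n * q)%:F / (nodepoly a n * nodepoly b n)%:F) = 0) ->
  (forall n,
     sigma ((P n * 'X^n)%:F / (nodepoly a n * nodepoly b n)%:F) = kappa n) ->
  reads_leading_coef a b kappa P sigma.
Proof.
move=> sigma_lin size_P sigma_orth sigma_kappa n q size_q.
have W_n (p : {poly F}) : (size p <= n.+1)%N ->
    rfspace a b ((P n * p)%:F / (nodepoly a n * nodepoly b n)%:F).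
  move=> size_p; exists n, (P n * p); split=> //.
  by rewrite (leq_trans (size_polyMleq _ _)) // size_P; lia.
pose p := q - q`_n *: 'X^n.
have size_p : (size p <= n)%N.
  apply/leq_sizeP => j; rewrite coefB coefZ coefXn leq_eqVlt.
  case: eqVneq => [-> _|_ /= lt_nj]; first by rewrite mulr1 subrr.
  by rewrite mulr0 subr0 nth_default // (leq_trans size_q).
have {1}-> : q = (q`_n)%:P * 'X^n + p by rewrite /p mul_polyC addrC subrK.
rewrite mulrDr mulrCA rmorphD rmorphM mulrDl -mulrA sigma_lin; first last.
- by apply: W_n; rewrite ltnW.
- by apply: W_n; rewrite size_polyXn.
rewrite sigma_kappa mulrC [X in _ + X](_ : _ = 0) ?addr0 //.
(* For n = 0 no orthogonality relation is available, but then p = 0. *)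
case: n {W_n size_q} p size_p => [|n] p size_p; last exact: sigma_orth size_p.
have /eqP -> : p == 0 by rewrite -size_poly_leq0.
by rewrite mulr0 rmorph0 mul0r (sigma0 sigma_lin).
Qed.

Lemma reads_leading_coefC a b kappa P sigma :
  reads_leading_coef a b kappa P sigma -> reads_leading_coef b a kappa P sigma.
Proof.
by move=> read n q size_q; rewrite [nodepoly b n * _]mulrC read.
Qed.

Lemma size_cofactor P b m n : size (P m) = m.+1 -> (m <= n)%N ->
  size (P m * node_tail b m n) = n.+1.
Proof.
move=> size_P le_mn.
rewrite size_Mmonic ?node_tail_monic -?size_poly_gt0 ?size_P //.
by rewrite size_node_tail; lia.
Qed.

Lemma rfspace_ratfun a b P : (forall n, size (P n) = n.+1) ->
  forall n m, rfspace a b (ratfun P a n * ratfun P b m).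
Proof.
move=> size_P n m.
wlog le_mn : a b n m / (m <= n)%N => [IH|].
  have /orP[/IH //|le_nm] := leq_total m n.
  by rewrite mulrC; apply: rfspaceC; exact: IH.
exists n, (P n * (P m * node_tail b m n)); rewrite ratfun_mulE //; split=> //.
by rewrite (leq_trans (size_polyMleq _ _)) // size_P size_cofactor //; lia.
Qed.

(** Over the larger of the two denominators, one of the numerators becomes [P n]
    and the other a monic cofactor of degree [n], whose leading coefficient is
    what [sigma] reads. *)
Lemma sigma_ratfun a b kappa P sigma :
  (forall n, P n \is monic /\ size (P n) = n.+1) ->
  reads_leading_coef a b kappa P sigma ->
  forall n m, sigma (ratfun P a n * ratfun P b m) = kappa (maxn n m).
Proof.
move=> P_monic read n m.
wlog le_mn : a b n m read / (m <= n)%N => [IH|].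
  have /orP[le_mn|le_nm] := leq_total m n; first exact: IH.
  by rewrite mulrC maxnC IH //; exact: reads_leading_coefC.
have [Pm_mon size_Pm] := P_monic m.
have size_c := size_cofactor b size_Pm le_mn.
rewrite ratfun_mulE // read ?size_c // (maxn_idPl le_mn).
have /monicP : P m * node_tail b m n \is monic by rewrite rpredM ?node_tail_monic.
by rewrite lead_coefE size_c /= => ->; rewrite mulr1.
Qed.

(** * Clearing the Gram matrix off the diagonal *)

(** The value at [0] makes [biorth_subZ] hold without a case distinction. *)
Definition xi0 kappa (n : nat) : F := if n is 0 then 0 else xi kappa n.

Lemma biorth_subZ P a kappa n : P 0%N = 1 ->
  biorth P a kappa n = ratfun P a n - (xi0 kappa n)%:P%:F * ratfun P a n.-1.
Proof.
case: n => [|n] // P0.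
by rewrite /= /ratfun P0 /nodepoly big_nil !rmorph0 rmorph1 mul0r subr0 divr1.
Qed.

Lemma xi0_kappa kappa n : (0 < n)%N -> kappa n.-1 != 0 ->
  xi0 kappa n * kappa n.-1 = kappa n.
Proof. by case: n => //= n _ k_neq0; rewrite /xi /= divfK. Qed.

Lemma sigma_biorth a b kappa P sigma : P 0%N = 1 ->
  (forall n, P n \is monic /\ size (P n) = n.+1) ->
  linear_functional_on (rfspace a b) sigma ->
  reads_leading_coef a b kappa P sigma ->
  forall n m, sigma (biorth P a kappa n * biorth P b kappa m)
    = kappa (maxn n m) - xi0 kappa n * kappa (maxn n.-1 m)
      - xi0 kappa m * (kappa (maxn n m.-1)
                       - xi0 kappa n * kappa (maxn n.-1 m.-1)).
Proof.
move=> P0 P_monic sigma_lin read n m.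
have W := rfspace_ratfun a b (fun k => (P_monic k).2).
have gram := sigma_ratfun P_monic read.
rewrite !biorth_subZ // mulrBr [X in _ - X]mulrCA !mulrBl -!(mulrA (xi0 kappa n)%:P%:F).
by rewrite !(sigma_subZ sigma_lin) ?gram //; do ?[exact: W | apply: rfspace_subZ].
Qed.

Lemma gram_maxn_clear kappa : (forall n, kappa n != 0) ->
  forall n m,
    kappa (maxn n m) - xi0 kappa n * kappa (maxn n.-1 m)
      - xi0 kappa m * (kappa (maxn n m.-1)
                       - xi0 kappa n * kappa (maxn n.-1 m.-1))
    = hnorm kappa n * (n == m)%:R.
Proof.
move=> kappa_neq0 n m.
have xiK k : (0 < k)%N -> xi0 kappa k * kappa k.-1 = kappa k.
  by move=> k_gt0; exact: xi0_kappa.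
have [lt_nm|lt_mn|<-] := ltngtP n m.
- rewrite !(maxn_idPr _); try lia.
  rewrite mulrBr (mulrCA (xi0 kappa m)) xiK; last lia.
  by rewrite subrr mulr0.
- rewrite !(maxn_idPl _); try lia.
  by rewrite xiK ?subrr ?mulr0 ?subr0 //; lia.
case: n => [|n]; first by rewrite /= !mul0r !subr0 mulr1.
rewrite ?maxnn (maxn_idPl (leqnSn n)) (maxn_idPr (leqnSn n)) xiK // subrr mulr0.
by rewrite subr0 mulr1 /= /xi /= mulrBr divfK.
Qed.

End BiorthogonalRationalFunctions.

Theorem theorem2p2 (R : realType)
  (a b alpha beta r kappa : nat -> R[i])
  (P : nat -> {poly R[i]})
  (sigma : {fraction {poly R[i]}} -> R[i])
  (alpha0 : alpha 0%N = -1)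
  (alpha_r : forall n, (1 <= n)%N -> alpha n + r n + 1 = 0)
  (r_neq0 : forall n, (1 <= n)%N -> r n != 0)
  (P0 : P 0%N = 1)
  (P1 : P 1%N = 'X - (beta 0%N)%:P)
  (Prec : forall n, (1 <= n)%N ->
     P n.+1 + ((alpha n)%:P * 'X + (beta n)%:P) * P n
       + (r n)%:P * ('X - (a n)%:P) * ('X - (b n)%:P) * P n.-1 = 0)
  (P_zeros : forall n i, (1 <= i)%N ->
     ~~ root (P n) (a i) /\ ~~ root (P n) (b i))
  (sigma_lin : linear_functional_on (rfspace a b) sigma)
  (sigma_orth : forall n j (q : {poly R[i]}), (j < n)%N -> (size q <= j.+1)%N ->
     sigma ((P n * q)%:F / (nodepoly a n * nodepoly b n)%:F) = 0)
  (sigma_kappa : forall n,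
     sigma ((P n * 'X^n)%:F / (nodepoly a n * nodepoly b n)%:F) = kappa n)
  (kappa_rec : forall n, (1 <= n)%N ->
     kappa n.+1 + alpha n * kappa n + r n * kappa n.-1 = 0)
  (kappa_neq0 : forall n, kappa n != 0)
  (kappa10 : kappa 1%N != kappa 0%N) :
  forall n m : nat,
    sigma (biorth P a kappa n * biorth P b kappa m)
    = hnorm kappa n * (n == m)%:R.
Proof.
have P_monic := recurrence_monic alpha_r P0 P1 Prec.
have read := orthogonal_reads_leading_coef sigma_lin (fun n => (P_monic n).2)
  sigma_orth sigma_kappa.
by move=> n m; rewrite (sigma_biorth P0 P_monic sigma_lin read) gram_maxn_clear.
Qed.
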